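(* There exists an absolute constant $C>0$ and an algorithm with the following guarantee. Let $k\ge2$, $n\ge1$, $\varepsilon\in(0,1]$, and let $P$ be a distribution on $[n]$ with $\mathrm{d_{TV}}(P,U_n)\ge\varepsilon$. Given $n,k,\varepsilon$, sample access to $P$, and sample access to distributions $D_1,\dots,D_k$ on $[n]$ each promised to be equal to $P$ or to $U_n$, the algorithm correctly classifies every $D_i$ as $P$ or $U_n$ with probability at least $8/9$, using in total (including samples from $P$) at most $C\frac{\sqrt{nk\log k}}{\varepsilon^2}$ samples if $n\ge k\log k$, and at most $C\frac{k\log k}{\varepsilon^2}$ samples if $n\le k\log k$.
   Context: $U_n$ is the uniform distribution on $[n]$; $\mathrm{d_{TV}}$ is total variation distance. Sample access means the algorithm may adaptively request independent samples from the distribution. *)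

(* Defs.v *)
From HB Require Import structures.
From mathcomp Require Import all_boot all_order all_algebra.
From Stdlib Require Import Rdefinitions Rpower R_sqrt.
From mathcomp Require Import Rstruct.
Set Implicit Arguments. Unset Strict Implicit. Unset Printing Implicit Defensive.
Import Order.TTheory GRing.Theory Num.Theory.
Local Open Scope ring_scope.

Notation R := Rdefinitions.R.

Definition is_distr (n : nat) (D : 'I_n -> R) : Prop :=
  (forall x, 0 <= D x) /\ \sum_(x < n) D x = 1.

Definition unif (n : nat) : 'I_n -> R := fun _ => n%:R^-1.
Arguments unif n : clear implicits.

Definition dTV (n : nat) (D1 D2 : 'I_n -> R) : R :=
  2^-1 * \sum_(x < n) `|D1 x - D2 x|.

(* A randomized adaptive sampling algorithm, as a (finite-path) decision tree.
   Sources are indexed by 'I_k.+1: index 0 is P, index i.+1 is D_(i+1).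
   - [Output f]     : stop and output f i = true meaning "D_i is P",
                      f i = false meaning "D_i is U_n";
   - [Sample j c]   : draw one fresh independent sample x from source j,
                      continue with c x;
   - [Flip c]       : flip a fair internal coin b, continue with c b. *)
Inductive alg (n k : nat) : Type :=
| Output of ('I_k -> bool)
| Sample of 'I_k.+1 & ('I_n -> alg n k)
| Flip of (bool -> alg n k).

Arguments Output {n k}.
Arguments Sample {n k}.
Arguments Flip {n k}.

Fixpoint succ_prob (n k : nat) (t : alg n k) (src : 'I_k.+1 -> 'I_n -> R)
    (good : ('I_k -> bool) -> bool) : R :=
  match t with
  | Output f => if good f then 1 else 0
  | Sample j c => \sum_(x < n) src j x * succ_prob (c x) src good
  | Flip c => 2^-1 * (succ_prob (c true) src good + succ_prob (c false) src good)
  end.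

Fixpoint nsamples (n k : nat) (t : alg n k) : nat :=
  match t with
  | Output _ => 0%N
  | Sample _ c => (\max_(x < n) nsamples (c x)).+1
  | Flip c => maxn (nsamples (c true)) (nsamples (c false))
  end.

Definition sources (n k : nat) (P : 'I_n -> R) (b : 'I_k -> bool)
    : 'I_k.+1 -> 'I_n -> R :=
  fun j => match unlift ord0 j with
           | None => P
           | Some i => if b i then P else unif n
           end.

Definition correct (k : nat) (b : 'I_k -> bool) (f : 'I_k -> bool) : bool :=
  [forall i, f i == b i].

Definition bound (C : R) (n k : nat) (eps : R) : R :=
  let klogk := k%:R * ln k%:R in
  if klogk <= n%:R then C * sqrt (n%:R * klogk) / eps ^+ 2
  else C * klogk / eps ^+ 2.

(* Main.v *)
Require Import Defs.
From HB Require Import structures.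
From mathcomp Require Import all_boot all_order all_algebra.
From Stdlib Require Import Rdefinitions Rpower R_sqrt.
From mathcomp Require Import Rstruct.
From mathcomp Require Import ring lra zify.
Import Order.TTheory GRing.Theory Num.Theory.
Local Open Scope ring_scope.

Set Implicit Arguments.
Unset Strict Implicit.
Unset Printing Implicit Defensive.

(* Stdlib captures the scope keys N and R and binds [R] to [R_scope]. *)
Delimit Scope nat_scope with N.
Delimit Scope ring_scope with R.
Bind Scope ring_scope with Rdefinitions.R.

(** Split the samples of [P] into [r] groups of [t <= (n+1)/2] samples and let
    [f x] be the number of groups that contain [x]. If [g p = 1 - (1-p)^t] is the
    probability that a group hits a point of mass [p], then
    [E <f, P - U_n> = r * sum_x (P x - 1/n) (g (P x) - g (1/n))] has nonnegative
    terms, and by convexity the points with [P x < 1/n] alone contribute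
    [r t eps^2 / (2 n)]. Concavity of [g] and negative correlation of the hitting
    events bound the variance of the gap [<f, P - U_n>] by [4 / t] times its mean,
    so the gap is large with high probability; since [g] is [t]-Lipschitz and
    bounded by 1, the variances of [f] under [P] and under [U_n] are controlled by
    the same mean, so heavy points of [P] cause no trouble. Hence
    [m ~ sqrt (n / (k log k)) / eps^2 + 1 / eps^2] samples of [D_i] suffice to
    classify [D_i] with constant error by comparing the empirical mean of [f] with
    its mean under [U_n]; a majority vote over [O(log k)] blocks brings the error
    below [1 / (18 k)], and the learned function [f] is shared by all the [D_i]. *)

(** * Expectations as positive linear functionals *)

(** Expectations stay abstract functionals because iterated draws are again of this kind: a group of
    samples or a block of samples then serves as a single draw. *)
Record is_mean (T : Type) (e : (T -> R) -> R) : Prop := IsMean {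
  mean_lin : forall a F G, e (fun x => a * F x + G x) = a * e F + e G;
  mean_le : forall F G, (forall x, F x <= G x) -> e F <= e G;
  mean1 : e (fun=> 1) = 1 }.

Section Mean.
Variables (T : Type) (e : (T -> R) -> R).
Hypothesis me : is_mean e.

Lemma mean_ext F G : (forall x, F x = G x) -> e F = e G.
Proof.
by move=> eqFG; apply/eqP; rewrite eq_le; apply/andP; split;
  apply: (mean_le me) => x; rewrite eqFG.
Qed.

Lemma meanD F G : e (fun x => F x + G x) = e F + e G.
Proof.
rewrite -[e F]mul1r -(mean_lin me); apply: mean_ext => x; by rewrite mul1r.
Qed.

Lemma mean0 : e (fun=> 0) = 0.
Proof.
have := meanD (fun=> 0) (fun=> 0).
rewrite (@mean_ext (fun=> 0 + 0) (fun=> 0)) => [|x]; last by rewrite addr0.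
by move/eqP; rewrite -subr_eq0 opprD addrA subrr sub0r oppr_eq0 => /eqP.
Qed.

Lemma meanZ a F : e (fun x => a * F x) = a * e F.
Proof.
by rewrite -[RHS]addr0 -mean0 -(mean_lin me); apply: mean_ext => x; rewrite addr0.
Qed.

Lemma mean_const a : e (fun=> a) = a.
Proof.
rewrite -[RHS]mulr1 -(mean1 me) -meanZ; apply: mean_ext => x; by rewrite mulr1.
Qed.

Lemma meanB F G : e (fun x => F x - G x) = e F - e G.
Proof.
rewrite -mulN1r -meanZ -meanD; apply: mean_ext => x; by rewrite mulN1r.
Qed.

Lemma mean_sum (I : Type) (s : seq I) (p : pred I) (F : I -> T -> R) :
  e (fun x => \sum_(i <- s | p i) F i x) = \sum_(i <- s | p i) e (F i).
Proof.
elim: s => [|i s IH].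
  by rewrite big_nil -[RHS]mean0; apply: mean_ext => x; rewrite big_nil.
rewrite big_cons -IH; case: ifP => pi.
  by rewrite -meanD; apply: mean_ext => x; rewrite big_cons pi.
by apply: mean_ext => x; rewrite big_cons pi.
Qed.

Lemma mean_ge0 F : (forall x, 0 <= F x) -> 0 <= e F.
Proof. by move=> F0; rewrite -mean0; apply: (mean_le me). Qed.

Lemma mean_predC (A : pred T) :
  e (fun x => (~~ A x)%:R) = 1 - e (fun x => (A x)%:R).
Proof.
rewrite -[X in X - _](mean1 me) -meanB; apply: mean_ext => x.
by case: (A x); rewrite /= ?subrr ?subr0.
Qed.

(** The two sides differ by [(e F - c) ^+ 2]. This allows one fixed centre for second moments under
    different sources. *)
Lemma mean_var_le F c : e (fun x => (F x - e F) ^+ 2) <= e (fun x => (F x - c) ^+ 2).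
Proof.
have -> : e (fun x => (F x - c) ^+ 2) =
    e (fun x => (F x - e F) ^+ 2) + (e F - c) ^+ 2.
  transitivity (e (fun x => (F x - e F) ^+ 2 +
     ((2 * (e F - c)) * F x + ((e F - c) ^+ 2 - 2 * (e F - c) * e F)))).
    by apply: mean_ext => x; rewrite !expr2; ring.
  by rewrite meanD (mean_lin me) mean_const !expr2; ring.
by rewrite lerDl sqr_ge0.
Qed.

End Mean.

Definition wmean (n : nat) (D : 'I_n -> R) (F : 'I_n -> R) : R :=
  \sum_(x < n) D x * F x.

Lemma is_mean_wmean (n : nat) (D : 'I_n -> R) : is_distr D -> is_mean (wmean D).
Proof.
case=> D0 D1; split.
- move=> a F G; rewrite /wmean mulr_sumr -big_split; apply: eq_bigr => x _ /=.
  by ring.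
- by move=> F G FG; apply: ler_sum => x _; apply: ler_wpM2l.
- by rewrite /wmean -[RHS]D1; apply: eq_bigr => x _; rewrite mulr1.
Qed.

(* The joint expectation of [N] independent draws, the [i]-th one from [es i]. *)
Fixpoint meanN (T : Type) (N : nat) (es : nat -> (T -> R) -> R)
    (F : seq T -> R) : R :=
  if N is N'.+1 then
    es 0%N (fun x => meanN N' (fun i => es i.+1) (fun s => F (x :: s)))
  else F [::].

Lemma meanN_le (T : Type) (N : nat) (es : nat -> (T -> R) -> R) F G :
  (forall i, is_mean (es i)) -> (forall s, size s = N -> F s <= G s) ->
  meanN N es F <= meanN N es G.
Proof.
elim: N es F G => [|N IH] es F G mes FG /=; first exact: FG.
apply: (mean_le (mes _)) => x; apply: IH => // s sN; apply: FG => /=.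
by rewrite sN.
Qed.

Lemma meanN_ext (T : Type) (N : nat) (es : nat -> (T -> R) -> R) F G :
  (forall i, is_mean (es i)) -> (forall s, size s = N -> F s = G s) ->
  meanN N es F = meanN N es G.
Proof.
by move=> mes FG; apply/eqP; rewrite eq_le; apply/andP; split;
  apply: meanN_le => // s sN; rewrite FG.
Qed.

Lemma is_mean_meanN (T : Type) (N : nat) (es : nat -> (T -> R) -> R) :
  (forall i, is_mean (es i)) -> is_mean (meanN N es).
Proof.
elim: N es => [|N IH] es mes /=; first by split.
have mN := IH _ (fun i => mes i.+1); split.
- move=> a F G; rewrite -(mean_lin (mes _)); apply: (mean_ext (mes _)) => x.
  by rewrite -(mean_lin mN).
- by move=> F G FG; apply: (mean_le (mes _)) => x; apply: (mean_le mN).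
- by rewrite -[RHS](mean1 (mes 0%N)); apply: (mean_ext (mes _)) => x; rewrite (mean1 mN).
Qed.

(** Markov's inequality, which becomes Chebyshev's when [X] is a square. The event is compared with
    [X] at length [N] only, because centring a sum uses the number of draws. *)
Lemma meanN_markov (T : Type) (N : nat) (es : nat -> (T -> R) -> R)
    (X : seq T -> R) (A : pred (seq T)) (a : R) :
  (forall i, is_mean (es i)) -> 0 < a -> (forall s, 0 <= X s) ->
  (forall s, size s = N -> A s -> a <= X s) ->
  meanN N es (fun s => (A s)%:R) <= meanN N es X / a.
Proof.
move=> mes a0 X0 AX; rewrite mulrC -(meanZ (is_mean_meanN N mes)).
apply: meanN_le => // s sN.
case: (boolP (A s)) => [As|_] /=; last by rewrite mulr_ge0 ?invr_ge0 // ltW.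
by rewrite ler_pdivlMl // mulr1 AX.
Qed.

Lemma meanN_nth (T : Type) (N : nat) (es : nat -> (T -> R) -> R) x0 i h :
  (forall i, is_mean (es i)) -> (i < N)%N ->
  meanN N es (fun s => h (nth x0 s i)) = es i h.
Proof.
elim: N es i => [//|N IH] es [|i] mes iN /=.
  apply: (mean_ext (mes _)) => x; apply: mean_const.
  exact: is_mean_meanN.
rewrite -[RHS](mean_const (mes 0%N)); apply: (mean_ext (mes _)) => x.
exact: (IH (fun i => es i.+1)).
Qed.

(** * Moments and majority votes of independent draws *)

Section IID.
Variables (T : Type) (e : (T -> R) -> R).
Hypothesis me : is_mean e.

Local Notation E N := (meanN N (fun=> e)).

Let mE N : is_mean (E N).
Proof. exact: is_mean_meanN. Qed.

Lemma iid_prod N (h : T -> R) : E N (fun s => \prod_(x <- s) h x) = e h ^+ N.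
Proof.
elim: N => [|N IH] /=; first by rewrite big_nil.
rewrite exprSr -IH -(meanZ me); apply: (mean_ext me) => x.
rewrite mulrC -(meanZ (mE N)); apply: (mean_ext (mE N)) => s.
by rewrite big_cons.
Qed.

Lemma iid_sum N (h : T -> R) : E N (fun s => \sum_(x <- s) h x) = N%:R * e h.
Proof.
elim: N => [|N IH] /=; first by rewrite big_nil mul0r.
transitivity (e (fun x => h x + N%:R * e h)).
  apply: (mean_ext me) => x; rewrite -IH -[X in X + _](mean_const (mE N)).
  by rewrite -(meanD (mE N)); apply: (mean_ext (mE N)) => s; rewrite big_cons.
by rewrite (meanD me) (mean_const me) -natr1; ring.
Qed.

Lemma iid_sum_sq N (h : T -> R) :
  E N (fun s => (\sum_(x <- s) h x) ^+ 2) =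
    N%:R * (e (fun x => h x ^+ 2) - e h ^+ 2) + (N%:R * e h) ^+ 2.
Proof.
elim: N => [|N IH] /=; first by rewrite big_nil; ring.
set v := E N _ in IH.
transitivity (e (fun x => h x ^+ 2 + ((2 * N%:R * e h) * h x + v))).
  apply: (mean_ext me) => x.
  transitivity (E N (fun s => h x ^+ 2 +
      (2 * h x * \sum_(y <- s) h y + (\sum_(y <- s) h y) ^+ 2))).
    by apply: (mean_ext (mE N)) => s; rewrite big_cons; ring.
  rewrite (meanD (mE N)) (mean_const (mE N)) (mean_lin (mE N)) iid_sum.
  rewrite -/v; ring.
rewrite (meanD me) (mean_lin me) (mean_const me) IH -natr1; ring.
Qed.

Lemma iid_sum_sq0 N (h : T -> R) : e h = 0 ->
  E N (fun s => (\sum_(x <- s) h x) ^+ 2) = N%:R * e (fun x => h x ^+ 2).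
Proof. by move=> h0; rewrite iid_sum_sq h0; ring. Qed.

(* Chernoff: the indicator of a wrong majority is at most the product of the
   factors 4 (wrong vote) and 1/4 (right vote), of expectation at most 1/2. *)
Lemma iid_majority N (bad : pred T) :
  e (fun x => (bad x)%:R) <= 16^-1 ->
  E N (fun s => (size s <= 2 * count bad s)%N%:R) <= 2^-1 ^+ N.
Proof.
move=> hbad; pose h x : R := if bad x then 4 else 4^-1.
have h0 x : 0 <= h x by rewrite /h; case: ifP => _; lra.
(* Multiplying by 4 per vote turns the factor of a wrong vote into 16 and that of a right vote into
   1. *)
have hE s : \prod_(x <- s) h x * 4 ^+ size s = 16 ^+ count bad s.
  elim: s => [|x s IH] /=; first by rewrite big_nil mulr1.
  rewrite big_cons exprS mulrACA IH exprD /h; case: ifP => _ /=.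
    by rewrite expr1; congr (_ * _); lra.
  by rewrite expr0; congr (_ * _); lra.
apply: (@le_trans _ _ (E N (fun s => \prod_(x <- s) h x))).
  apply: (mean_le (mE N)) => s; case: leqP => hs /=; last exact: prodr_ge0.
  have p4 : 0 < 4 ^+ size s :> R by apply: exprn_gt0; lra.
  rewrite -(ler_pM2r p4) hE mul1r.
  have -> : 16 = 4 ^+ 2 :> R by rewrite expr2; lra.
  rewrite -exprM; apply: ler_weXn2l => //; lra.
rewrite iid_prod; apply: lerXn2r; rewrite ?nnegrE ?(mean_ge0 me) //; first lra.
(* [h] is affine in the wrong-vote indicator, so its mean is at most [15/4 * 1/16 + 1/4 = 31/64]. *)
rewrite (@mean_ext _ _ me h (fun x => 15 / 4 * (bad x)%:R + 4^-1)).
  by rewrite (mean_lin me) (mean_const me); lra.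
by move=> x; rewrite /h; case: ifP => _ /=; lra.
Qed.

End IID.

(** * Hitting probabilities of a group of samples *)

Definition hit (t : nat) (p : R) : R := 1 - (1 - p) ^+ t.

Section Hit.
Implicit Types (x y p q : R) (t : nat).

(** Convexity of the power: a chord is at least as steep as the tangent at its smaller end. *)
Lemma subX_ge t x y : 0 <= y -> y <= x ->
  t.+1%:R * (x - y) * y ^+ t <= x ^+ t.+1 - y ^+ t.+1.
Proof.
move=> y0 yx; elim: t => [|t IH]; first by rewrite !expr1 expr0; lra.
have yt : 0 <= y ^+ t by apply: exprn_ge0.
have t0 : 0 <= t.+1%:R :> R by rewrite ler0n.
have -> : x ^+ t.+2 - y ^+ t.+2 =
    x * (x ^+ t.+1 - y ^+ t.+1) + (x - y) * y ^+ t.+1 by rewrite !exprS; ring.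
have : y * (t.+1%:R * (x - y) * y ^+ t) <= x * (x ^+ t.+1 - y ^+ t.+1).
  apply: ler_pM => //; apply: mulr_ge0 => //; apply: mulr_ge0 => //; lra.
by rewrite -[t.+2%:R]natr1 !exprS; lra.
Qed.

Lemma subX_le t x y : 0 <= y -> y <= x -> x <= 1 ->
  x ^+ t - y ^+ t <= t%:R * (x - y).
Proof.
move=> y0 yx x1; elim: t => [|t IH]; first by rewrite !expr0; lra.
have yt : 0 <= y ^+ t <= 1.
  by rewrite exprn_ge0 //= exprn_ile1 // (le_trans yx).
have xt : y ^+ t <= x ^+ t by apply: lerXn2r; rewrite ?nnegrE //; lra.
have h1 : x * (x ^+ t - y ^+ t) <= x ^+ t - y ^+ t.
  by rewrite ler_piMl // subr_ge0.
have h2 : (x - y) * y ^+ t <= x - y.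
  by rewrite ler_piMr ?subr_ge0 //; case/andP: yt.
by rewrite -natr1 !exprS; lra.
Qed.

Lemma hit_ge0 t p : 0 <= p <= 1 -> 0 <= hit t p.
Proof. by move=> p01; rewrite /hit subr_ge0 exprn_ile1 //; lra. Qed.

Lemma hit_le1 t p : 0 <= p <= 1 -> hit t p <= 1.
Proof.
move=> p01; have : 0 <= (1 - p) ^+ t by apply: exprn_ge0; lra.
by rewrite /hit lerBlDr lerDl.
Qed.

Lemma hit_le t p : 0 <= p <= 1 -> hit t p <= t%:R * p.
Proof.
move=> /andP[p0 p1]; have := @subX_le t 1 (1 - p).
rewrite expr1n /hit subr_ge0 gerBl opprB addrCA subrr addr0; exact.
Qed.

Lemma hit_mono t p q : 0 <= p <= 1 -> 0 <= q <= 1 -> p <= q -> hit t p <= hit t q.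
Proof.
move=> p01 q01 pq; rewrite /hit lerD2l lerN2.
by apply: lerXn2r; rewrite ?nnegrE; lra.
Qed.

Lemma hit_corr_ge0 t p q : 0 <= p <= 1 -> 0 <= q <= 1 ->
  0 <= (p - q) * (hit t p - hit t q).
Proof.
move=> p01 q01; have [pq|/ltW pq] := leP p q; have := hit_mono t _ _ pq.
  by move/(_ p01 q01) => H; apply: mulr_le0; rewrite subr_le0.
by move/(_ q01 p01) => H; apply: mulr_ge0; rewrite subr_ge0.
Qed.

(** [hit t] is increasing and [t]-Lipschitz, so one factor of the square is traded for
    [t * (p - q)]. *)
Lemma hit_lipschitz t p q : 0 <= p <= 1 -> 0 <= q <= 1 ->
  (hit t p - hit t q) ^+ 2 <= t%:R * ((p - q) * (hit t p - hit t q)).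
Proof.
wlog pq : p q / p <= q => [W p01 q01|p01 q01].
  have [|/ltW] := leP p q => pq; first exact: W.
  by have := W q p pq q01 p01; rewrite !expr2; lra.
have := hit_mono t p01 q01 pq.
have := @subX_le t (1 - p) (1 - q); rewrite /hit.
set a := (1 - p) ^+ t; set b := (1 - q) ^+ t => H hm.
have {}H : a - b <= t%:R * (q - p).
  have -> : q - p = 1 - p - (1 - q) by ring.
  by apply: H; lra.
have u0 : 0 <= a - b by lra.
have := ler_wpM2l u0 H; rewrite expr2; lra.
Qed.

(* Concavity of [hit]: its slope between [p] and [q] is at least the slope
   at the larger of the two points. *)
Lemma hit_slope t p q : 0 <= p <= 1 -> 0 <= q <= 1 -> p <= q ->
  t.+1%:R * (q - p) * (1 - q) ^+ t <= hit t.+1 q - hit t.+1 p.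
Proof.
move=> p01 q01 pq; have := @subX_ge t (1 - p) (1 - q); rewrite /hit => H.
have {}H := H _ _; move: H; set a := (1 - q) ^+ t; set b := _ ^+ _; set c := _ ^+ _ => H.
by have {}H : t.+1%:R * (1 - p - (1 - q)) * a <= b - c; [apply: H; lra | lra].
Qed.

(** To the left of [q], concavity and the lower bound on [(1 - q) ^+ t] make the slope at least
    [t.+1 / 2]. *)
Lemma hit_light t p q : 0 <= p <= 1 -> 0 <= q <= 1 -> p <= q ->
  2^-1 <= (1 - q) ^+ t ->
  t.+1%:R * (q - p) ^+ 2 <= 2 * ((p - q) * (hit t.+1 p - hit t.+1 q)).
Proof.
move=> p01 q01 pq hq; have := hit_slope t p01 q01 pq.
have t0 : 0 <= t.+1%:R * (q - p) by rewrite mulr_ge0 ?ler0n ?subr_ge0.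
set a := _ * _ in t0 *; rewrite expr2 mulrA -/a => H.
have : a * 2^-1 <= hit t.+1 q - hit t.+1 p.
  by apply: le_trans H; apply: ler_wpM2l.
nra.
Qed.

(** Charges the variance of a hitting indicator to its correlation term. For [p <= q] the variance
    is at most 1 and [hit_light] suffices. For [p > q] one has [1 - hit t.+1 p <= (1 - p) ^+ t], the
    very factor in the slope bound at [p]. *)
Lemma hit_var t p q : 0 <= p <= 1 -> 0 <= q <= 1 -> 2^-1 <= (1 - q) ^+ t ->
  t.+1%:R * ((p - q) ^+ 2 * (hit t.+1 p * (1 - hit t.+1 p))) <=
    2 * ((p - q) * (hit t.+1 p - hit t.+1 q)).
Proof.
move=> p01 q01 hq.
have h0 := hit_ge0 t.+1 p01; have h1 := hit_le1 t.+1 p01.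
have t0 : 0 <= t.+1%:R :> R by rewrite ler0n.
have [pq|/ltW qp] := leP p q.
  apply: le_trans (hit_light p01 q01 pq hq); apply: ler_wpM2l => //.
  have -> : (q - p) ^+ 2 = (p - q) ^+ 2 * 1 by rewrite !expr2; ring.
  by apply: ler_wpM2l; [exact: sqr_ge0 | nra].
have := hit_slope t q01 p01 qp; set d := hit _ _ - hit _ _ => H.
have e1 : 1 - hit t.+1 p <= (1 - p) ^+ t.
  rewrite /hit opprB addrC subrK exprS ler_piMl //; last lra.
  by apply: exprn_ge0; lra.
have {H} : t.+1%:R * (p - q) * (hit t.+1 p * (1 - hit t.+1 p)) <= d.
  apply: le_trans H; apply: ler_wpM2l; first by rewrite mulr_ge0 ?subr_ge0.
  by apply: le_trans e1; nra.
move=> H; have d0 : 0 <= p - q by lra.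
have := ler_wpM2l d0 H; have := hit_corr_ge0 t.+1 p01 q01; rewrite -/d.
rewrite expr2; lra.
Qed.

End Hit.

(** * Negative correlation of the hitting events within a group *)

Section Group.
Variables (n t : nat) (P : 'I_n -> R).
Hypothesis dP : is_distr P.

Local Notation e := (meanN t (fun=> wmean P)).

Let mP : is_mean (wmean P). Proof. exact: is_mean_wmean. Qed.
Let me : is_mean e. Proof. exact: is_mean_meanN. Qed.

Lemma distr_ge0_le1 x : 0 <= P x <= 1.
Proof.
case: dP => P0 P1; rewrite P0 /= -P1 (bigD1 x) //= lerDl.
by apply: sumr_ge0.
Qed.

Lemma group_avoid (A : pred 'I_n) :
  e (fun s => (~~ has A s)%:R) = (1 - \sum_(x | A x) P x) ^+ t.
Proof.
transitivity (e (fun s => \prod_(x <- s) (~~ A x)%:R)).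
  apply: (mean_ext me); elim=> [|x s IH] /=; first by rewrite big_nil.
  by rewrite big_cons -IH negb_or; case: (A x); rewrite /= ?mul0r ?mul1r.
rewrite iid_prod //; congr (_ ^+ _).
rewrite (mean_predC mP) /wmean; congr (_ - _).
rewrite [RHS]big_mkcond; apply: eq_bigr => x _.
by case: (A x); rewrite ?mulr1 ?mulr0.
Qed.

Lemma group_hit x : e (fun s => (x \in s)%:R) = hit t (P x).
Proof.
have <- : \sum_(y | pred1 x y) P y = P x by exact: big_pred1_eq.
rewrite /hit -group_avoid -[X in X - _](mean1 me) -(meanB me).
apply: (mean_ext me) => s; rewrite has_pred1.
by case: (x \in s); rewrite /= ?subr0 ?subrr.
Qed.

(** For distinct points inclusion-exclusion reduces negative correlation to
    [1 - (P x + P y) <= (1 - P x) * (1 - P y)], raised to the power [t]. *)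
Lemma group_cov x y :
  e (fun s => ((x \in s)%:R - hit t (P x)) * ((y \in s)%:R - hit t (P y))) <=
    if x == y then hit t (P x) * (1 - hit t (P x)) else 0.
Proof.
set hx := hit t (P x); set hy := hit t (P y).
have -> : e (fun s => ((x \in s)%:R - hx) * ((y \in s)%:R - hy)) =
    e (fun s => (x \in s)%:R * (y \in s)%:R) - hx * hy.
  transitivity (e (fun s => (x \in s)%:R * (y \in s)%:R +
     ((- hx) * (y \in s)%:R + ((- hy) * (x \in s)%:R + hx * hy)))).
    by apply: (mean_ext me) => s; ring.
  rewrite (meanD me) (mean_lin me) (mean_lin me) (mean_const me) !group_hit.
  by rewrite -/hx -/hy; ring.
case: eqVneq => [xy|xy].
  have -> : hy = hx by rewrite /hy -xy.
  rewrite -{}xy (_ : e _ = hx); first lra.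
  rewrite /hx -group_hit; apply: (mean_ext me) => s.
  by case: (x \in s); rewrite ?mulr0 ?mulr1.
have -> : e (fun s => (x \in s)%:R * (y \in s)%:R) =
    hx + hy - 1 + (1 - (P x + P y)) ^+ t.
  have -> : P x + P y = \sum_(z | pred2 x y z) P z.
    rewrite (bigD1 x) /= ?eqxx // (bigD1 y) /= ?eqxx ?orbT 1?eq_sym //=.
    rewrite big1 ?addr0 // => z /andP[/andP[+ zx] zy].
    by rewrite (negbTE zx) (negbTE zy).
  rewrite -group_avoid /hx /hy -!group_hit.
  rewrite -[X in _ - X](mean1 me) -!(meanD me) -(meanB me) -(meanD me).
  apply: (mean_ext me) => s.
  have -> : has (pred2 x y) s = (x \in s) || (y \in s).
    by rewrite -!has_pred1 -has_predU; apply: eq_has.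
  by case: (x \in s); case: (y \in s); rewrite /=; lra.
have px := distr_ge0_le1 x; have py := distr_ge0_le1 y.
(* Keeps the base [1 - (P x + P y)] nonnegative, so that taking powers preserves the order. *)
have pxy : P x + P y <= 1.
  case: dP => P0 <-; rewrite (bigD1 x) // (bigD1 y) 1?eq_sym //=.
  by rewrite lerD2l lerDl; apply: sumr_ge0.
have : (1 - (P x + P y)) ^+ t <= ((1 - P x) * (1 - P y)) ^+ t.
  by apply: lerXn2r; rewrite ?nnegrE; nra.
rewrite exprMn /hx /hy /hit; set a := _ ^+ _; set b := _ ^+ _; set c := _ ^+ _; lra.
Qed.

(** With nonnegative weights the off-diagonal covariances contribute nothing positive and are
    dropped. *)
Lemma group_var_ge0 (a : 'I_n -> R) : (forall x, 0 <= a x) ->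
  e (fun s => (\sum_x a x * ((x \in s)%:R - hit t (P x))) ^+ 2) <=
    \sum_x a x ^+ 2 * (hit t (P x) * (1 - hit t (P x))).
Proof.
move=> a0; pose I x (s : seq 'I_n) : R := (x \in s)%:R - hit t (P x).
have -> : e (fun s => (\sum_x a x * I x s) ^+ 2) =
    \sum_x \sum_y a x * a y * e (fun s => I x s * I y s).
  transitivity (e (fun s => \sum_x \sum_y a x * a y * (I x s * I y s))).
    apply: (mean_ext me) => s; rewrite expr2 big_distrlr /=.
    by apply: eq_bigr => x _; apply: eq_bigr => y _; ring.
  rewrite (mean_sum me); apply: eq_bigr => x _.
  rewrite (mean_sum me); apply: eq_bigr => y _; exact: meanZ.
apply: ler_sum => x _; rewrite (bigD1 x) //= -[leRHS]addr0; apply: lerD.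
  rewrite -expr2; apply: ler_wpM2l; first exact: sqr_ge0.
  by have := group_cov x x; rewrite eqxx.
apply: sumr_le0 => y yx; apply: mulr_ge0_le0; first exact: mulr_ge0.
by have := group_cov x y; rewrite eq_sym (negbTE yx).
Qed.

(** Weights of opposite signs would flip the sign of a covariance, so positive and negative parts
    are bounded separately; [(u - v)^2 <= 2 u^2 + 2 v^2] costs the factor 2. *)
Lemma group_var (d : 'I_n -> R) :
  e (fun s => (\sum_x d x * ((x \in s)%:R - hit t (P x))) ^+ 2) <=
    2 * \sum_x d x ^+ 2 * (hit t (P x) * (1 - hit t (P x))).
Proof.
pose a x := Num.max (d x) 0; pose b x := Num.max (- d x) 0.
have abE x : [/\ 0 <= a x, 0 <= b x, d x = a x - b x & d x ^+ 2 = a x ^+ 2 + b x ^+ 2].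
  by rewrite /a /b; case: (leP (d x) 0) => h1; case: (leP (- d x) 0) => h2;
    split; rewrite ?expr2; nra.
pose X c (s : seq 'I_n) : R := \sum_x c x * ((x \in s)%:R - hit t (P x)).
apply: (@le_trans _ _ (e (fun s => 2 * X a s ^+ 2 + 2 * X b s ^+ 2))).
  apply: (mean_le me) => s.
  have -> : \sum_x d x * ((x \in s)%:R - hit t (P x)) = X a s - X b s.
    rewrite /X -sumrB; apply: eq_bigr => x _; case: (abE x) => _ _ -> _.
    by rewrite mulrBl.
  by have := sqr_ge0 (X a s + X b s); rewrite !expr2; lra.
rewrite (mean_lin me) (meanZ me) -mulrDr; apply: ler_wpM2l; first lra.
have -> : \sum_x d x ^+ 2 * (hit t (P x) * (1 - hit t (P x))) =
   \sum_x a x ^+ 2 * (hit t (P x) * (1 - hit t (P x))) +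
   \sum_x b x ^+ 2 * (hit t (P x) * (1 - hit t (P x))).
  rewrite -big_split; apply: eq_bigr => x _ /=; case: (abE x) => _ _ _ ->.
  by rewrite mulrDl.
by apply: lerD; apply: group_var_ge0 => x; case: (abE x).
Qed.

End Group.

(** * Learning a distinguishing function from samples of [P] *)

Definition hits (n : nat) (gs : seq (seq 'I_n)) (x : 'I_n) : R :=
  \sum_(g <- gs) (x \in g)%:R.

Lemma sum_subr_const (T : Type) (s : seq T) (A : T -> R) (c : R) :
  \sum_(x <- s) (A x - c) = \sum_(x <- s) A x - (size s)%:R * c.
Proof.
elim: s => [|x s IH] /=; first by rewrite !big_nil mul0r subr0.
by rewrite !big_cons IH -natr1; ring.
Qed.

Section Learn.
Variables (n t' r : nat) (P : 'I_n -> R) (eps : R).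

Local Notation t := t'.+1.
Local Notation q := (n%:R^-1 : R).
Local Notation h0 := (hit t q).
Local Notation E := (meanN r (fun=> meanN t (fun=> wmean P))).

Hypotheses (dP : is_distr P) (n0 : (0 < n)%N) (r0 : (0 < r)%N).
Hypothesis hq : 2^-1 <= (1 - q) ^+ t'.
Hypothesis tn : (t <= n)%N.
Hypothesis eps0 : 0 < eps.
Hypothesis farP : eps <= dTV P (unif n).

(** The mean contribution of one group to the gap; subtracting [h0] is free because the deviations
    [P x - q] sum to 0. *)
Definition corr : R := \sum_x (P x - q) * (hit t (P x) - h0).
Definition signal : R := r%:R * corr.
Definition gap (f : 'I_n -> R) : R := \sum_x (P x - q) * f x.
(** Second moments of [f] under [P] and under the uniform distribution, added, about the common
    centre [r * h0], which is the mean of [hits] at a point of mass [1/n]. *)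
Definition spread (f : 'I_n -> R) : R :=
  \sum_x (P x + q) * (f x - r%:R * h0) ^+ 2.
Definition spread_bound : R := 2 * (r%:R * t%:R * q) + 4 * (r%:R * signal).

Let mg : is_mean (meanN t (fun=> wmean P)).
Proof. by apply: is_mean_meanN => _; apply: is_mean_wmean. Qed.

Let mE : is_mean E.
Proof. exact: is_mean_meanN. Qed.

Let nR : 0 < n%:R :> R. Proof. by rewrite ltr0n. Qed.

Let q01 : 0 <= q <= 1.
Proof. by rewrite invr_ge0 ler0n invf_le1 // ler1n. Qed.

Let nq : n%:R * q = 1.
Proof. by rewrite mulfV // gt_eqF. Qed.

Let sum_dev : \sum_x (P x - q) = 0.
Proof.
case: dP => _ P1; rewrite sumrB P1 -[X in _ - X]mulr1.
by rewrite sumr_const card_ord -(mulr_natl q) nq mulr1 subrr.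
Qed.

Let Pb x := distr_ge0_le1 dP x.

(** The deficits [a x] of the light points sum to the total variation distance. The tangent
    inequality [a^2 >= 2 l a - l^2] at [l = eps / n] plays the role of Cauchy-Schwarz; heavy points
    contribute nonnegative terms. *)
Lemma corr_ge : t%:R * eps ^+ 2 * q <= 2 * corr.
Proof.
pose l := eps * q; pose a x : R := (`|P x - q| - (P x - q)) / 2.
have l0 : 0 <= l by rewrite mulr_ge0 // ?(ltW eps0); case/andP: q01.
have ha : \sum_x a x = dTV P (unif n).
  by rewrite /a -mulr_suml sumrB sum_dev subr0 mulrC.
have sum_l : \sum_(x < n) l ^+ 2 = eps ^+ 2 * q.
  rewrite sumr_const card_ord -[LHS]mulr_natl /l.
  transitivity (eps ^+ 2 * q * (n%:R * q)); first by ring.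
  by rewrite nq mulr1.
apply: (@le_trans _ _ (\sum_x t%:R * (2 * l * a x - l ^+ 2))).
  rewrite -mulr_sumr sumrB -mulr_sumr ha sum_l -mulrA; apply: ler_wpM2l => //.
  rewrite expr2; have := ler_wpM2l l0 farP; rewrite /l; lra.
rewrite /corr mulr_sumr; apply: ler_sum => x _.
have [pq|/ltW qp] := leP (P x) q.
  apply: le_trans (hit_light (Pb x) q01 pq hq); apply: ler_wpM2l => //.
  have -> : a x = q - P x by rewrite /a ler0_norm ?subr_le0 //; lra.
  by have := sqr_ge0 (q - P x - l); rewrite !expr2; lra.
have -> : a x = 0 by rewrite /a ger0_norm ?subr_ge0 // subrr mul0r.
apply: (@le_trans _ _ 0).
  rewrite mulr0 sub0r; apply: mulr_ge0_le0 => //; rewrite oppr_le0; exact: sqr_ge0.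
by rewrite mulr_ge0 // hit_corr_ge0.
Qed.

Lemma signal_gt0 : 0 < signal.
Proof.
rewrite /signal mulr_gt0 ?ltr0n //.
have : 0 < t%:R * eps ^+ 2 * q by rewrite !mulr_gt0 ?exprn_gt0 ?invr_gt0 ?ltr0n.
by have := corr_ge; lra.
Qed.

Lemma spread_bound_gt0 : 0 < spread_bound.
Proof.
have rR : 0 < r%:R :> R by rewrite ltr0n.
have tR : 0 < t%:R :> R by rewrite ltr0n.
have qR : 0 < q by rewrite invr_gt0.
have := mulr_gt0 rR signal_gt0; have := mulr_gt0 (mulr_gt0 rR tR) qR.
rewrite /spread_bound; lra.
Qed.

Let sum_devM (u : 'I_n -> R) c : \sum_x (P x - q) * (u x - c) = \sum_x (P x - q) * u x.
Proof.
under eq_bigr do rewrite mulrBr.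
by rewrite sumrB -mulr_suml sum_dev mul0r subr0.
Qed.

Lemma gap_hits gs : size gs = r -> gap (hits gs) =
  \sum_(g <- gs) (\sum_x (P x - q) * ((x \in g)%:R - hit t (P x))) + signal.
Proof.
move=> sgs; rewrite /gap /signal /corr sum_devM /hits -sgs.
under [in RHS]eq_bigr => g _ do under eq_bigr => x _ do rewrite mulrBr.
under [in RHS]eq_bigr => g _ do rewrite sumrB.
rewrite sum_subr_const subrK exchange_big /=.
by apply: eq_bigr => x _; rewrite mulr_sumr.
Qed.

(** Chebyshev: the gap has mean [signal] and variance at most [4 * signal / t], and it must deviate
    by [signal / 2]. *)
Lemma gap_small :
  E (fun gs => (gap (hits gs) < signal / 2)%R%:R) <= 16 / (t%:R * signal).
Proof.
pose psi (g : seq 'I_n) : R := \sum_x (P x - q) * ((x \in g)%:R - hit t (P x)).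
have s0 := signal_gt0; have tR : 0 < t%:R :> R by rewrite ltr0n.
have s2 : 0 < (signal / 2) ^+ 2 by rewrite exprn_gt0 // divr_gt0.
have psi0 : meanN t (fun=> wmean P) psi = 0.
  rewrite /psi (mean_sum mg) big1 // => x _.
  by rewrite (meanZ mg) (meanB mg) (mean_const mg) group_hit // subrr mulr0.
(* The 4 is a factor 2 from [group_var] times a factor 2 from [hit_var]. *)
have psi2 : t%:R * meanN t (fun=> wmean P) (fun g => psi g ^+ 2) <= 4 * corr.
  have := group_var t dP (fun x => P x - q); rewrite -(ler_pM2l tR) => H.
  apply: le_trans H _; rewrite mulrCA.
  have -> : 4 * corr = 2 * (2 * corr) by ring.
  apply: ler_wpM2l => //; rewrite /corr !mulr_sumr; apply: ler_sum => x _.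
  exact: hit_var.
apply: le_trans (meanN_markov (X := fun gs => (\sum_(g <- gs) psi g) ^+ 2)
  (fun=> mg) s2 _ _) _.
- by move=> gs; apply: sqr_ge0.
- move=> gs sgs; rewrite gap_hits // -/psi; set u := \sum_(g <- gs) _ => hu.
  have : 0 <= (- u - signal / 2) * (- u + signal / 2) by apply: mulr_ge0; lra.
  by rewrite !expr2; lra.
rewrite iid_sum_sq0 // ler_pdivrMr //.
have alg_id (T s : R) : 0 < T -> 0 < s -> 16 / (T * s) * (s / 2) ^+ 2 = 4 * s / T.
  by move=> T0 s1; field; rewrite !gt_eqF.
rewrite alg_id //.
rewrite ler_pdivlMr // /signal.
have := ler_wpM2l (ler0n R r) psi2; lra.
Qed.

(** Variance plus squared bias of a count of successes in [r] independent trials of probability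
    [hit t (P x)]. *)
Lemma hits_sq x :
  E (fun gs => (hits gs x - r%:R * h0) ^+ 2) =
    r%:R * (hit t (P x) * (1 - hit t (P x))) + r%:R ^+ 2 * (hit t (P x) - h0) ^+ 2.
Proof.
pose f (g : seq 'I_n) : R := (x \in g)%:R - h0.
have -> : E (fun gs => (hits gs x - r%:R * h0) ^+ 2) =
    E (fun gs => (\sum_(g <- gs) f g) ^+ 2).
  by apply: meanN_ext => // gs sgs; rewrite /f sum_subr_const sgs.
rewrite iid_sum_sq // /f (meanB mg) (mean_const mg) group_hit //.
have -> : meanN t (fun=> wmean P) (fun g => ((x \in g)%:R - h0) ^+ 2) =
    (1 - 2 * h0) * hit t (P x) + h0 ^+ 2.
  rewrite -group_hit // -[X in _ + X](mean_const mg) -(mean_lin mg).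
  by apply: (mean_ext mg) => g; case: (x \in g); rewrite /= !expr2; ring.
by rewrite !expr2; ring.
Qed.

Lemma spread_mean : E (fun gs => spread (hits gs)) <= spread_bound.
Proof.
rewrite /spread (mean_sum mE).
under eq_bigr do rewrite (meanZ mE) hits_sq.
pose h x := hit t (P x).
have Pq x : 0 <= P x + q by apply: addr_ge0; [case/andP: (Pb x) | case/andP: q01].
have corr0 : 0 <= corr by apply: sumr_ge0 => x _; apply: hit_corr_ge0.
have hb x : 0 <= h x <= 1 by rewrite /h hit_ge0 // hit_le1.
have h0b : 0 <= h0 <= 1 by rewrite hit_ge0 // hit_le1.
have tq : t%:R * q <= 1 by rewrite ler_pdivrMr // mul1r ler_nat.
(* Variance part: with [P x + q = (P x - q) + 2 q], the first summand yields [corr] and the second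
   is bounded by [hit t p <= t p]. *)
have A1 : \sum_x (P x + q) * (h x * (1 - h x)) <= corr + 2 * (t%:R * q).
  apply: (@le_trans _ _ (\sum_x ((P x - q) * h x + (2 * q * t%:R) * P x))).
    apply: ler_sum => x _; have := hit_le t (Pb x); rewrite -/(h x) => hx.
    have : (P x + q) * (h x * (1 - h x)) <= (P x + q) * h x.
      by apply: ler_wpM2l => //; have := hb x; nra.
    have : q * h x <= q * (t%:R * P x).
      by apply: ler_wpM2l => //; case/andP: q01.
    lra.
  rewrite big_split /= -mulr_sumr; case: dP => _ ->.
  by rewrite /corr sum_devM mulr1 -/h; lra.
(* Bias part, with the same splitting: [h x - h0 <= 1] bounds the first summand by [y], the
   Lipschitz bound and [t q <= 1] bound the second by [2 y]. *)
have A2 : \sum_x (P x + q) * (h x - h0) ^+ 2 <= 3 * corr.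
  rewrite /corr mulr_sumr; apply: ler_sum => x _.
  have c0 := hit_corr_ge0 t (Pb x) q01; have lip := hit_lipschitz t (Pb x) q01.
  move: c0 lip; rewrite -/(h x); set y := (P x - q) * _ => c0 lip.
  have -> : (P x + q) * (h x - h0) ^+ 2 = y * (h x - h0) + 2 * (q * (h x - h0) ^+ 2).
    by rewrite /y !expr2; ring.
  have : y * (h x - h0) <= y by apply: ler_piMr => //; have := hb x; lra.
  have : q * (h x - h0) ^+ 2 <= q * (t%:R * y).
    by apply: ler_wpM2l => //; case/andP: q01.
  have : t%:R * q * y <= y by apply: ler_piMl.
  lra.
have rR : 1 <= r%:R :> R by rewrite ler1n.
have -> : \sum_x (P x + q) * (r%:R * (hit t (P x) * (1 - hit t (P x))) +
       r%:R ^+ 2 * (hit t (P x) - h0) ^+ 2) =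
    r%:R * (\sum_x (P x + q) * (h x * (1 - h x))) +
    r%:R ^+ 2 * (\sum_x (P x + q) * (h x - h0) ^+ 2).
  rewrite !mulr_sumr -big_split; apply: eq_bigr => x _ /=; rewrite /h; ring.
have r00 : 0 <= r%:R :> R by lra.
have := ler_wpM2l r00 A1; have := ler_wpM2l (sqr_ge0 (r%:R : R)) A2.
(* As [r >= 1], the single [r corr] of the variance part joins the [3 r^2 corr] of the bias part. *)
have : r%:R * corr <= r%:R * (r%:R * corr).
  by apply: ler_wpM2l => //; apply: ler_peMl.
rewrite /spread_bound /signal expr2; lra.
Qed.

Definition good_hits (f : 'I_n -> R) : bool :=
  (signal / 2 <= gap f) && (spread f <= 32 * spread_bound).

(** Union bound: the gap fails with probability at most 1/64 and, by Markov, the spread with at most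
    1/32. The sum 3/64 is below 1/18, half of the allowed error. *)
Lemma good_hits_whp : 1024 <= t%:R * signal ->
  E (fun gs => (~~ good_hits (hits gs))%:R) <= 18^-1.
Proof.
move=> big; have b0 := spread_bound_gt0.
apply: (@le_trans _ _ (E (fun gs => (gap (hits gs) < signal / 2)%R%:R +
   (32 * spread_bound < spread (hits gs))%R%:R))).
  apply: (mean_le mE) => gs; rewrite /good_hits negb_and -!ltNge.
  by case: (_ < _); case: (_ < _); rewrite /= ?addr0 ?add0r // lerDl.
rewrite (meanD mE).
have H1 : 16 / (t%:R * signal) <= 64^-1 by rewrite ler_pdivrMr; lra.
have H2 : E (fun gs => (32 * spread_bound < spread (hits gs))%R%:R) <= 32^-1.
  apply: le_trans (meanN_markov (X := fun gs => spread (hits gs))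
    (a := 32 * spread_bound) (fun=> mg) _ _ _) _.
  - by rewrite mulr_gt0.
  - move=> gs; apply: sumr_ge0 => x _; apply: mulr_ge0; last exact: sqr_ge0.
    by apply: addr_ge0; [case/andP: (Pb x) | case/andP: q01].
  - by move=> gs _ /ltW.
  rewrite ler_pdivrMr ?mulr_gt0 //; have := spread_mean; lra.
by apply: le_trans (lerD (le_trans gap_small H1) H2) _; lra.
Qed.

End Learn.

(** * Testing a block of samples, and the majority vote *)

Section Test.
Variables (n m : nat) (f : 'I_n -> R) (c w : R).

Definition stat (ys : seq 'I_n) : R :=
  \sum_(y <- ys) (f y - wmean (unif n) f).

(* The threshold is [16 m] times an upper bound on the variance of [f] under
   the uniform distribution; [w] only serves to make it positive. *)
Definition accept (ys : seq 'I_n) : bool :=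
  (0 < stat ys) &&
  (16 * (m%:R * (wmean (unif n) (fun x => (f x - c) ^+ 2) + w)) < stat ys ^+ 2).

Hypotheses (n0 : (0 < n)%N) (m0 : (0 < m)%N) (w0 : 0 < w).

Lemma is_distr_unif : is_distr (unif n).
Proof.
split=> [x|]; first by rewrite invr_ge0 ler0n.
rewrite sumr_const card_ord -[LHS]mulr_natl mulfV // pnatr_eq0 -lt0n //.
Qed.

Let mU : is_mean (wmean (unif n)).
Proof. exact: is_mean_wmean is_distr_unif. Qed.

Let mR : 0 < m%:R :> R. Proof. by rewrite ltr0n. Qed.

Let M2_ge0 : 0 <= wmean (unif n) (fun x => (f x - c) ^+ 2).
Proof. by apply: (mean_ge0 mU) => x; apply: sqr_ge0. Qed.

(** Chebyshev: [stat] is centred here, and the squared threshold is at least 16 times its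
    variance. *)
Lemma accept_unif :
  meanN m (fun=> wmean (unif n)) (fun ys => (accept ys)%:R) <= 16^-1.
Proof.
set M2 := wmean (unif n) (fun x => (f x - c) ^+ 2).
have a0 : 0 < 16 * (m%:R * (M2 + w)).
  by rewrite mulr_gt0 // mulr_gt0 // ltr_wpDl.
apply: le_trans (meanN_markov (X := fun ys => stat ys ^+ 2) (fun=> mU) a0 _ _) _.
- by move=> ys; apply: sqr_ge0.
- by move=> ys _ /andP[_ /ltW].
rewrite ler_pdivrMr // /stat iid_sum_sq0 //; last first.
  by rewrite (meanB mU) (mean_const mU) subrr.
have := ler_wpM2l (ltW mR) (mean_var_le mU f c); rewrite -/M2.
have := mulr_gt0 mR w0; lra.
Qed.

(** Here [stat] has mean at least [m mu / 2], while rejection forces it below [m mu / 4]: the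
    squared threshold is at most [32 m v], and [512 = 32 * 16] places this under [(m mu / 4)^2].
    Chebyshev then applies with variance at most [m v]. *)
Lemma accept_far (P : 'I_n -> R) (v mu : R) :
  is_distr P -> 0 < mu -> w <= v -> 512 * v <= m%:R * mu ^+ 2 ->
  mu / 2 <= gap P f -> \sum_x (P x + n%:R^-1) * (f x - c) ^+ 2 <= v ->
  meanN m (fun=> wmean P) (fun ys => (~~ accept ys)%:R) <= 16^-1.
Proof.
move=> dP mu0 wv vm hgap hv; have mP := is_mean_wmean dP.
set M2 := wmean (unif n) (fun x => (f x - c) ^+ 2).
set V := wmean P (fun x => (f x - c) ^+ 2).
have VM : V + M2 <= v.
  rewrite /V /M2 /wmean -big_split /=; apply: le_trans hv.
  by apply: ler_sum => x _; rewrite mulrDl.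
have V0 : 0 <= V by apply: (mean_ge0 mP) => x; apply: sqr_ge0.
have gapE : gap P f = wmean P f - wmean (unif n) f.
  by rewrite /gap /wmean -sumrB; apply: eq_bigr => x _; rewrite mulrBl.
have mm : 0 < m%:R * mu by rewrite mulr_gt0.
have a0 : 0 < (m%:R * mu / 4) ^+ 2 by rewrite exprn_gt0 // divr_gt0.
pose X ys := (\sum_(y <- ys) (f y - wmean P f)) ^+ 2.
have big : 32 * (m%:R * v) <= (m%:R * mu / 4) ^+ 2.
  have := ler_wpM2l (ltW mR) vm; rewrite !expr2; lra.
apply: le_trans (meanN_markov (X := X) (fun=> mP) a0 _ _) _.
- by move=> ys; apply: sqr_ge0.
- move=> ys sys; rewrite /X.
  have -> : \sum_(y <- ys) (f y - wmean P f) = stat ys - m%:R * gap P f.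
    by rewrite /stat !sum_subr_const sys gapE; ring.
  have mg := ler_wpM2l (ltW mR) hgap.
  rewrite /accept negb_and -!leNgt -/M2; set Z := stat ys => hZ.
  have {}hZ : Z <= m%:R * mu / 4.
    rewrite leNgt; apply/negP => Zbig.
    have Z2 : (m%:R * mu / 4) ^+ 2 < Z ^+ 2.
      by rewrite ltrXn2r // ?nnegrE; lra.
    have := ler_wpM2l (ltW mR) wv; have := ler_wpM2l (ltW mR) VM.
    have := mulr_ge0 (ltW mR) V0.
    by case/orP: hZ => hZ; lra.
  have : 0 <= (m%:R * gap P f - Z - m%:R * mu / 4) * (m%:R * gap P f - Z + m%:R * mu / 4).
    by apply: mulr_ge0; lra.
  by rewrite !expr2; lra.
rewrite ler_pdivrMr // /X iid_sum_sq0 //; last first.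
  by rewrite (meanB mP) (mean_const mP) subrr.
have := ler_wpM2l (ltW mR) (mean_var_le mP f c); rewrite -/V.
have := ler_wpM2l (ltW mR) VM; have := mulr_ge0 (ltW mR) M2_ge0; rewrite -/M2; lra.
Qed.

End Test.

(** * The algorithm *)

(** Continuation-passing form: a procedure that draws a [T] and hands it to the rest of the tree.
    Repeating a sampler gives a sampler of sequences, so loops nest. *)
Definition sampler (n k : nat) (T : Type) := (T -> alg n k) -> alg n k.

Fixpoint sampN (n k : nat) (T : Type) (N : nat) (S : nat -> sampler n k T)
    (c : seq T -> alg n k) : alg n k :=
  if N is N'.+1 then
    S 0%N (fun x => sampN N' (fun i => S i.+1) (fun s => c (x :: s)))
  else c [::].

Lemma succ_prob_sampN (n k : nat) (T : Type) (src : 'I_k.+1 -> 'I_n -> R)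
    (good : ('I_k -> bool) -> bool) (N : nat) (S : nat -> sampler n k T)
    (es : nat -> (T -> R) -> R) (c : seq T -> alg n k) :
  (forall i, is_mean (es i)) ->
  (forall i c', succ_prob (S i c') src good =
    es i (fun x => succ_prob (c' x) src good)) ->
  succ_prob (sampN N S c) src good =
    meanN N es (fun s => succ_prob (c s) src good).
Proof.
elim: N S es c => [//|N IH] S es c mes hS /=; rewrite hS.
by apply: (mean_ext (mes _)) => x; apply: (IH _ (fun i => es i.+1)).
Qed.

Lemma nsamples_sampN (n k : nat) (T : Type) (N w B : nat)
    (S : nat -> sampler n k T) (c : seq T -> alg n k) :
  (forall i c' B', (forall x, nsamples (c' x) <= B')%N ->
    (nsamples (S i c') <= w + B')%N) ->
  (forall s, nsamples (c s) <= B)%N -> (nsamples (sampN N S c) <= N * w + B)%N.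
Proof.
elim: N S c => [|N IH] S c hS hc /=; first exact: hc.
rewrite mulSn -addnA; apply: (hS 0%N) => x; apply: IH => [i c' B'|s]; last exact: hc.
exact: hS.
Qed.

Definition majority (T : Type) (a : pred T) (s : seq T) : bool :=
  (size s < 2 * count a s)%N.

(* [r] groups of [t] samples of [P] determine the function [hits]; then each
   source is classified by a majority vote over [q] blocks of [m] samples. *)
Definition classifier (n k r t m q : nat) : alg n k :=
  sampN r (fun=> sampN t (fun=> Sample ord0)) (fun gs =>
    sampN k (fun i => sampN q (fun=> sampN m (fun=> Sample (inord i.+1)))) (fun res =>
      Output (fun i => majority
        (accept m (hits gs) (r%:R * hit t n%:R^-1) (r%:R * t%:R * n%:R^-1))
        (nth [::] res i)))).

Lemma nsamples_classifier (n k r t m q : nat) :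
  (nsamples (classifier n k r t m q) <= r * t + k * (q * m))%N.
Proof.
have one (j : 'I_k.+1) N (c : seq 'I_n -> alg n k) B :
    (forall s, nsamples (c s) <= B)%N ->
    (nsamples (sampN N (fun=> Sample j) c) <= N + B)%N.
  move=> hc; rewrite -[N in (N + B)%N]muln1; apply: nsamples_sampN => // _ c' B' hB.
  by rewrite /= add1n ltnS; apply/bigmax_leqP => x _.
apply: nsamples_sampN => [_ c B hc|gs]; first exact: one.
rewrite -[X in (_ <= X)%N]addn0; apply: nsamples_sampN => // i c B hc.
by apply: nsamples_sampN => // j c' B' hc'; exact: one.
Qed.

Lemma is_distr_sources (n k : nat) (P : 'I_n -> R) (b : 'I_k -> bool) j :
  (0 < n)%N -> is_distr P -> is_distr (sources P b j).
Proof.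
move=> n0 dP; rewrite /sources; case: (unlift _ _) => [i|//].
by case: (b i) => //; apply: is_distr_unif.
Qed.

Lemma sources_inord (n k : nat) (P : 'I_n -> R) (b : 'I_k -> bool) (i : 'I_k) :
  sources P b (inord i.+1) = if b i then P else unif n.
Proof.
have -> : inord i.+1 = lift ord0 i.
  by apply: val_inj; rewrite /= inordK // ltnS.
by rewrite /sources liftK.
Qed.

(** A wrong outcome of the strict majority means that at least half of the votes are wrong, ties
    included, which is the event of [iid_majority]. *)
Lemma majority_wrong (T : Type) (e : (T -> R) -> R) (q : nat) (a : pred T) (b : bool) :
  is_mean e -> e (fun x => (a x != b)%:R) <= 16^-1 ->
  meanN q (fun=> e) (fun s => (majority a s != b)%:R) <= 2^-1 ^+ q.
Proof.
move=> me /(iid_majority me q); apply: le_trans.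
apply: meanN_le => // s _; rewrite ler_nat /majority.
have := count_predC a s; set bad := fun x => a x != b.
case: b @bad => bad hs.
  have -> : count bad s = count (predC a) s.
    by apply: eq_count => x; rewrite /bad /=; case: (a x).
  case: (ltnP (size s) _) => //= h; rewrite lt0b.
  by rewrite -hs; move: h; rewrite -hs; lia.
have -> : count bad s = count a s.
  by apply: eq_count => x; rewrite /bad /=; case: (a x).
by case: (ltnP (size s) _) => //= /ltnW ->.
Qed.

(** * Error probability of the classifier *)

Section Classify.
Variables (n k r t' m q : nat) (P : 'I_n -> R) (eps : R) (b : 'I_k -> bool).
Local Notation t := t'.+1.
Hypotheses (dP : is_distr P) (n0 : (0 < n)%N) (r0 : (0 < r)%N) (m0 : (0 < m)%N).
Hypothesis hq : 2^-1 <= (1 - n%:R^-1 : R) ^+ t'.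
Hypothesis tn : (t <= n)%N.
Hypothesis eps0 : 0 < eps.
Hypothesis farP : eps <= dTV P (unif n).
Hypothesis signal_big : 1024 <= t%:R * signal t' r P.
Hypothesis block_big : 512 * (32 * spread_bound t' r P) <= m%:R * signal t' r P ^+ 2.
Hypothesis votes : (18 * k <= expn 2 q)%N.

(** The error budget 1/9 is split evenly: 1/18 for learning a bad function, and [k * 2^-q <= 1/18]
    for the union bound over the [k] votes. *)
Lemma classifier_correct :
  8 / 9 <= succ_prob (classifier n k r t m q) (sources P b) (correct b).
Proof.
have mP := is_mean_wmean dP.
have msrc j : is_mean (wmean (sources P b j)).
  by apply: is_mean_wmean; apply: is_distr_sources.
pose blk (i : nat) := meanN m (fun=> wmean (sources P b (inord i.+1))).
have mblk i : is_mean (blk i) by apply: is_mean_meanN.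
pose es i := meanN q (fun=> blk i).
have mes i : is_mean (es i) by apply: is_mean_meanN.
have mg : is_mean (meanN t (fun=> wmean P)) by apply: is_mean_meanN.
rewrite /classifier.
rewrite (@succ_prob_sampN _ _ _ _ _ _ _ (fun=> meanN t (fun=> wmean P))) //; last first.
  move=> i c; apply: succ_prob_sampN => // _ c' /=.
  by rewrite /sources unlift_none.
pose acc (gs : seq (seq 'I_n)) :=
  accept m (hits gs) (r%:R * hit t n%:R^-1) (r%:R * t%:R * n%:R^-1).
pose wrong gs (i : 'I_k) (s : seq (seq 'I_n)) := majority (acc gs) s != b i.
set F := (X in meanN _ _ X).
have mE := is_mean_meanN r (fun=> mg).
(* Conditioning on the learned function: for a bad one the left side is negative and nothing remains
   to prove. *)
suff hF gs : 17 / 18 - (~~ good_hits t' r P (hits gs))%:R <= F gs.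
  apply: le_trans (mean_le mE hF).
  rewrite (meanB mE) (mean_const mE).
  have := good_hits_whp dP n0 r0 hq tn eps0 farP signal_big; lra.
rewrite /F (@succ_prob_sampN _ _ _ _ _ _ _ es) //; last first.
  by move=> i c; apply: succ_prob_sampN => // _ c'; apply: succ_prob_sampN.
case: (boolP (good_hits _ _ _ _)) => [/andP[hgap hspr] /=|_ /=]; last first.
  apply: (@le_trans _ _ 0); first lra.
  by apply: (mean_ge0 (is_mean_meanN k mes)) => s; case: ifP.
have w0 : 0 < r%:R * t%:R * n%:R^-1 :> R by rewrite !mulr_gt0 ?invr_gt0 ?ltr0n.
have sig0 := signal_gt0 dP n0 r0 hq eps0 farP.
have err (i : 'I_k) : es i (fun s => (wrong gs i s)%:R) <= 2^-1 ^+ q.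
  apply: majority_wrong => //; rewrite /blk sources_inord; case: (b i).
    rewrite (@mean_ext _ _ (is_mean_meanN m (fun=> mP)) _
      (fun ys => (~~ acc gs ys)%:R)) => [|ys]; last by case: (acc gs ys).
    apply: (accept_far n0 m0 dP sig0 _ block_big hgap hspr).
    (* The slack [w = r t / n] lies below the first summand of [spread_bound]. *)
    have : 0 < r%:R * signal t' r P by rewrite mulr_gt0 // ltr0n.
    rewrite /spread_bound; lra.
  have mU := is_mean_wmean (is_distr_unif n0).
  rewrite (@mean_ext _ _ (is_mean_meanN m (fun=> mU)) _
      (fun ys => (acc gs ys)%:R)) => [|ys]; last by case: (acc gs ys).
  exact: accept_unif.
have mK := is_mean_meanN k mes.
(* The success indicator is at least 1 minus the number of misclassified sources. *)
apply: (@le_trans _ _ (meanN k es (fun res =>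
    1 - \sum_(i < k) (wrong gs i (nth [::] res i))%:R))).
  rewrite (meanB mK) (mean1 mK) (mean_sum mK) subr0.
  have : \sum_(i < k) meanN k es (fun res => (wrong gs i (nth [::] res i))%:R) <=
      \sum_(i < k) 2^-1 ^+ q.
    apply: ler_sum => i _.
    by rewrite (@meanN_nth _ k es [::] i (fun s => (wrong gs i s)%:R)).
  rewrite sumr_const card_ord => H.
  have : 2^-1 ^+ q *+ k <= 18^-1 :> R.
    rewrite -mulr_natl exprVn ler_pdivrMr ?exprn_gt0 //.
    have : (18 * k)%:R <= (expn 2 q)%:R :> R by rewrite ler_nat.
    by rewrite natrM natrX; lra.
  by move: H; lra.
apply: (mean_le mK) => res; case: ifP => [_|].
  by rewrite gerBl sumr_ge0.
move/negbT; rewrite negb_forall => /existsP[i hi].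
rewrite (bigD1 i) //= /wrong hi opprD addrA subrr sub0r oppr_le0.
exact: sumr_ge0.
Qed.

End Classify.

(** * Choice of the parameters *)

(** To be read with [y = r t / n], [z = t / n], [s] the signal and [e = eps]. Each summand on the
    left takes at most half of [m s^2]: the [y] term by bounding both factors [s] below, the [r s]
    term by bounding one. *)
Lemma block_arith (m y z r s e : R) :
  0 <= m -> 0 <= y -> 0 <= r -> 0 < s ->
  y * e ^+ 2 / 2 <= s -> r * z * e ^+ 2 / 2 <= s ->
  64 * 64 * 64 <= m * y * e ^+ 4 -> 64 * 64 * 64 <= m * z * e ^+ 2 ->
  512 * (32 * (2 * y + 4 * (r * s))) <= m * s ^+ 2.
Proof.
move=> m0 y0 r0 s0 ys zs H1 H2.
have ye0 : 0 <= y * e ^+ 2 / 2 by rewrite divr_ge0 // mulr_ge0 // sqr_ge0.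
have s2 : (y * e ^+ 2 / 2) ^+ 2 <= s ^+ 2 by apply: lerXn2r; rewrite ?nnegrE // ltW.
have h1 : 64 * 64 * 16 * y <= m * s ^+ 2.
  apply: le_trans (ler_wpM2l m0 s2).
  have -> : m * (y * e ^+ 2 / 2) ^+ 2 = y * (m * y * e ^+ 4) / 4 by field.
  have := ler_wpM2l y0 H1; lra.
have h2 : 64 * 64 * 32 * (r * s) <= m * s ^+ 2.
  have h3 : 64 * 64 * 32 * r <= m * s.
    by have := ler_wpM2l m0 zs; have := ler_wpM2l r0 H2; lra.
  have := ler_wpM2r (ltW s0) h3; rewrite expr2; lra.
lra.
Qed.

Section Conditions.
Variables (n r t' m : nat) (P : 'I_n -> R) (eps : R).
Local Notation t := t'.+1.
Local Notation q := (n%:R^-1 : R).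
Hypotheses (dP : is_distr P) (n0 : (0 < n)%N) (r0 : (0 < r)%N).
Hypothesis hq : 2^-1 <= (1 - q) ^+ t'.
Hypothesis eps0 : 0 < eps.
Hypothesis farP : eps <= dTV P (unif n).

Let q0 : 0 < q. Proof. by rewrite invr_gt0 ltr0n. Qed.
Let nq : n%:R * q = 1. Proof. by rewrite mulfV // pnatr_eq0 -lt0n. Qed.

Lemma signal_ge : r%:R * t%:R * q * eps ^+ 2 / 2 <= signal t' r P.
Proof.
have := ler_wpM2l (ler0n R r) (corr_ge dP n0 hq eps0 farP).
rewrite /signal; lra.
Qed.

Lemma signal_suff : 2048 * n%:R <= t%:R * (r%:R * t%:R) * eps ^+ 2 ->
  1024 <= t%:R * signal t' r P.
Proof.
move=> /(ler_wpM2r (ltW q0)) H.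
have := ler_wpM2l (ler0n R t) signal_ge.
have -> : 1024 = 2048 * (n%:R * q) / 2 by rewrite nq; lra.
lra.
Qed.

Lemma block_suff :
  64 * 64 * 64 * n%:R <= m%:R * (r%:R * t%:R) * eps ^+ 4 ->
  64 * 64 * 64 * n%:R <= m%:R * t%:R * eps ^+ 2 ->
  512 * (32 * spread_bound t' r P) <= m%:R * signal t' r P ^+ 2.
Proof.
move=> /(ler_wpM2r (ltW q0)) H1 /(ler_wpM2r (ltW q0)) H2.
rewrite -[leLHS]mulrA nq in H1; rewrite -[leLHS]mulrA nq in H2.
have sge := signal_ge.
have s0 := signal_gt0 dP n0 r0 hq eps0 farP.
have y0 : 0 <= r%:R * t%:R * q by rewrite mulr_ge0 ?(ltW q0) // mulr_ge0.
have zs : r%:R * (t%:R * q) * eps ^+ 2 / 2 <= signal t' r P by rewrite mulrA.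
have {}H1 : 64 * 64 * 64 <= m%:R * (r%:R * t%:R * q) * eps ^+ 4 by lra.
have {}H2 : 64 * 64 * 64 <= m%:R * (t%:R * q) * eps ^+ 2 by lra.
exact: (block_arith (ler0n R m) y0 (ler0n R r) s0 sge zs H1 H2).
Qed.

End Conditions.

(** * Logarithmic number of votes *)

Section Votes.
Variable k : nat.

Definition klogk : R := k%:R * ln k%:R.
Definition nvotes : nat := (trunc_log 2 k + 6)%N.

(** Of the 6 extra votes one lifts the power of 2 above [k], and the other five give [32 >= 18]. *)
Lemma nvotes_ge : (18 * k <= expn 2 nvotes)%N.
Proof.
have := trunc_log_ltn k (isT : 1 < 2)%N; rewrite /nvotes expnD expnS.
by rewrite (_ : expn 2 6 = 64)%N //; lia.
Qed.

Hypothesis k2 : (2 <= k)%N.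

Lemma ln_ge_half : 2^-1 <= ln k%:R.
Proof.
have /RltP h : (Rlt (Rinv (IZR 2)) (ln (IZR 2))) := ln_lt_2.
have e2 : IZR 2 = 2 by rewrite IZRposE INRE.
rewrite RinvE e2 in h; apply: le_trans (ltW h) _.
have : 2 <= k%:R :> R by rewrite ler_nat.
rewrite le_eqVlt => /orP[/eqP -> //|/RltP lt2k].
apply/ltW/RltP/ln_increasing => //; apply/RltP; rewrite //.
Qed.

Lemma klogk_ge1 : 1 <= klogk.
Proof.
have : 2 <= k%:R :> R by rewrite ler_nat.
rewrite /klogk; have := ln_ge_half; nra.
Qed.

(** Since [ln 2 > 1/2], the truncated logarithm is at most [2 ln k], and [6 <= 12 ln k]. *)
Lemma nvotes_le : nvotes%:R <= 14 * ln k%:R.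
Proof.
have lk := ln_ge_half.
suff : (trunc_log 2 k)%:R <= 2 * ln k%:R by rewrite /nvotes natrD; lra.
have k0 : (0 < k)%N by apply: leq_trans k2.
have hle : (2 ^+ trunc_log 2 k <= k%:R :> R).
  by rewrite -natrX ler_nat trunc_logP.
have /RltP h : (Rlt (Rinv (IZR 2)) (ln (IZR 2))) := ln_lt_2.
have e2 : IZR 2 = 2 by rewrite IZRposE INRE.
rewrite RinvE e2 in h.
have lnX : ln (2 ^+ trunc_log 2 k) = (trunc_log 2 k)%:R * ln 2.
  by rewrite -RpowE ln_pow ?INRE //; apply/RltP.
have : (trunc_log 2 k)%:R * ln 2 <= ln k%:R.
  rewrite -lnX; move: hle; rewrite le_eqVlt => /orP[/eqP -> //|/RltP hlt].
  by apply/ltW/RltP/ln_increasing => //; apply/RltP; rewrite exprn_gt0.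
have := ler_wpM2l (ler0n R (trunc_log 2 k)) (ltW h); lra.
Qed.

End Votes.

(** * Sample sizes and total cost *)

Section Sizes.
Variables (n k : nat) (eps : R).
Local Notation klogk := (klogk k).
Local Notation nvotes := (nvotes k).

Definition budget : R := bound 1 n k eps.
Definition nlearn : nat := (Num.trunc (4096 * budget)).+1.
(** The cap at half of [n], rounded up, keeps [(1 - 1/n)^(t-1)] at least 1/2. *)
Definition ngroup : nat := minn nlearn (uphalf n).
Definition ngroups : nat := (nlearn %/ ngroup).+1.
(** Chosen so that [k * nvotes * nblock], of order [klogk * nblock], is of order [budget]. *)
Definition nblock : nat := (Num.trunc (64 * 64 * 128 * (budget / klogk))).+1.

Hypotheses (k2 : (2 <= k)%N) (n0 : (0 < n)%N) (eps0 : 0 < eps) (eps1 : eps <= 1).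

Lemma boundE C : bound C n k eps = C * budget.
Proof. by rewrite /budget /bound /=; case: ifP => _; rewrite mul1r -[LHS]mulrA. Qed.

(** In both regimes [budget * eps^2] is the maximum of [klogk] and [sqrt (n * klogk)]. This bound
    and the next record the two halves, so the regimes need not be separated again. *)
Lemma budget_ge : klogk <= budget * eps ^+ 2.
Proof.
have e2 : 0 < eps ^+ 2 by rewrite exprn_gt0.
have L1 := klogk_ge1 k2; have L0 : 0 <= klogk by lra.
rewrite /budget /bound -/klogk; case: ifP => [Ln|_]; rewrite mul1r divfK ?gt_eqF //.
rewrite RsqrtE -[leLHS]ger0_norm // -sqrtr_sqr ler_sqrt.
  by rewrite expr2 ler_wpM2r.
by rewrite mulr_ge0.
Qed.

Lemma budget_sq_ge : n%:R * klogk <= budget ^+ 2 * eps ^+ 4.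
Proof.
have e2 : 0 < eps ^+ 2 by rewrite exprn_gt0.
have L1 := klogk_ge1 k2; have L0 : 0 <= klogk by lra.
have -> : budget ^+ 2 * eps ^+ 4 = (budget * eps ^+ 2) ^+ 2 by rewrite exprMn -exprM.
rewrite /budget /bound -/klogk; case: ifP => [_|/negbT];
  rewrite mul1r divfK ?gt_eqF //.
  by rewrite RsqrtE sqr_sqrtr // mulr_ge0.
by rewrite -ltNge => /ltW nL; rewrite expr2 ler_wpM2r.
Qed.

Let budget_ge1 : 1 <= budget.
Proof.
have b := budget_ge; have L1 := klogk_ge1 k2.
have e2 : 0 < eps ^+ 2 <= 1 by rewrite exprn_gt0 //= exprn_ile1 // ltW.
nra.
Qed.

Lemma ngroup_gt0 : (0 < ngroup)%N.
Proof. by rewrite leq_min /= /nlearn; case: n n0. Qed.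

Lemma ngroups_ge : (nlearn <= ngroups * ngroup)%N.
Proof. by apply: ltnW; rewrite /ngroups ltn_ceil // ngroup_gt0. Qed.

Lemma ngroups_le : (ngroups * ngroup <= 2 * nlearn)%N.
Proof.
rewrite /ngroups mulSn mul2n -addnn leq_add ?leq_trunc_div //; exact: geq_minl.
Qed.

Let nlearn_ge : 4096 * budget <= nlearn%:R.
Proof. exact/ltW/truncnS_gt. Qed.

Let nblock_ge : 64 * 64 * 128 * (budget / klogk) <= nblock%:R.
Proof. exact/ltW/truncnS_gt. Qed.

Lemma nlearn_le : nlearn%:R <= 4097 * budget.
Proof.
have h : 0 <= 4096 * budget by have := budget_ge1; lra.
have : (Num.trunc (4096 * budget))%:R <= 4096 * budget by rewrite truncn_le.
by rewrite /nlearn -natr1; have := budget_ge1; lra.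
Qed.

Let ratio_ge : 1 <= (budget / klogk) * eps ^+ 2.
Proof.
have L1 := klogk_ge1 k2; have L0 : 0 < klogk by lra.
rewrite mulrAC ler_pdivlMr // mul1r; exact: budget_ge.
Qed.

Let ratio_ge1 : 1 <= budget / klogk.
Proof.
have := ratio_ge.
have e2 : 0 < eps ^+ 2 <= 1 by rewrite exprn_gt0 //= exprn_ile1 // ltW.
nra.
Qed.

Lemma nblock_le : nblock%:R <= (64 * 64 * 128 + 1) * (budget / klogk).
Proof.
have r1 := ratio_ge1.
have h : 0 <= 64 * 64 * 128 * (budget / klogk) by lra.
move: h; rewrite -truncn_le /nblock -natr1; lra.
Qed.

(** Rounding the number of groups at most doubles the learning samples, and rounding up each size
    costs one unit since [budget] and [budget / klogk] are at least 1. In the voting cost the factor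
    [k ln k] cancels [klogk]. *)
Lemma total_le :
  (ngroups * ngroup + k * (nvotes * nblock))%:R <=
    (2 * 4097 + 14 * (64 * 64 * 128 + 1)) * budget.
Proof.
have L1 := klogk_ge1 k2; have L0 : 0 < klogk by lra.
have h1 : (ngroups * ngroup)%:R <= 2 * (4097 * budget).
  apply: le_trans (_ : (2 * nlearn)%:R <= _); first by rewrite ler_nat ngroups_le.
  by rewrite natrM; apply: ler_wpM2l => //; apply: nlearn_le.
have h2 : (k * (nvotes * nblock))%:R <=
    k%:R * (14 * ln k%:R * ((64 * 64 * 128 + 1) * (budget / klogk))).
  rewrite !natrM; apply: ler_wpM2l => //.
  by apply: ler_pM => //; [exact: nvotes_le k2 | exact: nblock_le].
have e : klogk * (budget / klogk) = budget by rewrite mulrCA mulfV ?mulr1 ?gt_eqF.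
have alg_id (a l c x : R) : a * (14 * l * (c * x)) = 14 * c * (a * l * x) by ring.
rewrite alg_id -/klogk e in h2.
by rewrite natrD; lra.
Qed.

Let group_cases : nlearn%:R <= ngroup%:R :> R \/ n%:R <= 2 * ngroup%:R :> R.
Proof.
rewrite /ngroup; case: leqP => _; first by left.
by right; rewrite -natrM ler_nat mul2n -leq_uphalf_double.
Qed.

Let budget_ratio_ge : n%:R <= budget * (budget / klogk) * eps ^+ 4.
Proof.
have L1 := klogk_ge1 k2; have L0 : 0 < klogk by lra.
have -> : budget * (budget / klogk) * eps ^+ 4 = (budget ^+ 2 * eps ^+ 4) / klogk.
  by rewrite expr2; ring.
by rewrite ler_pdivlMr // budget_sq_ge.
Qed.

Let eps4_le_eps2 : 0 <= eps ^+ 4 <= eps ^+ 2.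
Proof.
have h := ltW eps0; rewrite exprn_ge0 //=.
by apply: ler_wiXn2l.
Qed.

Let nlearn_le_total : nlearn%:R <= ngroups%:R * ngroup%:R :> R.
Proof. by rewrite -natrM ler_nat ngroups_ge. Qed.

Lemma block_total_ge :
  64 * 64 * 64 * n%:R <= nblock%:R * (ngroups%:R * ngroup%:R) * eps ^+ 4.
Proof.
have b1 := budget_ge1; have r1 := ratio_ge1; have [e4 _] := andP eps4_le_eps2.
have : 64 * 64 * 128 * (budget / klogk) * (4096 * budget) * eps ^+ 4 <=
    nblock%:R * (ngroups%:R * ngroup%:R) * eps ^+ 4.
  apply: ler_wpM2r => //; apply: ler_pM; first lra; first lra.
    exact: nblock_ge.
  exact: le_trans nlearn_ge nlearn_le_total.
by have := budget_ratio_ge; have := ler0n R n; lra.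
Qed.

(** If the group holds all [nlearn] samples, the product is of order [budget^2 / klogk], which
    controls [n / eps^4]. Otherwise [ngroup >= n / 2], and [nblock * eps^2] is bounded below by a
    constant. *)
Lemma block_group_ge : 64 * 64 * 64 * n%:R <= nblock%:R * ngroup%:R * eps ^+ 2.
Proof.
have b1 := budget_ge1; have r1 := ratio_ge1; have [e4 e42] := andP eps4_le_eps2.
have e2 : 0 <= eps ^+ 2 by apply: sqr_ge0.
have n0R := ler0n R n.
case: group_cases => hg.
  have : 64 * 64 * 128 * (budget / klogk) * (4096 * budget) * eps ^+ 4 <=
      nblock%:R * ngroup%:R * eps ^+ 2.
    apply: ler_pM => //; first by apply: mulr_ge0; lra.
    apply: ler_pM; first lra; first lra; first exact: nblock_ge.
    exact: le_trans nlearn_ge hg.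
  by have := budget_ratio_ge; lra.
(* The 128 is [2 * 64]: the 2 pays for [n <= 2 * ngroup]. *)
have : 64 * 64 * 128 * (budget / klogk * eps ^+ 2) * n%:R <=
    nblock%:R * eps ^+ 2 * (2 * ngroup%:R).
  apply: ler_pM => //; first by have := ratio_ge; lra.
  by rewrite mulrA; apply: ler_wpM2r => //; exact: nblock_ge.
by have := ler_wpM2r n0R ratio_ge; lra.
Qed.

(** Same two cases: either [nlearn^2 * eps^4] dominates [n * klogk], or [ngroup >= n / 2] and
    [nlearn * eps^2 >= 4096], with [4096 = 2 * 2048]. *)
Lemma learn_ge :
  2048 * n%:R <= ngroup%:R * (ngroups%:R * ngroup%:R) * eps ^+ 2.
Proof.
have b1 := budget_ge1; have r1 := ratio_ge1; have [e4 e42] := andP eps4_le_eps2.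
have e2 : 0 <= eps ^+ 2 by apply: sqr_ge0.
have n0R := ler0n R n; have L1 := klogk_ge1 k2.
have hs := le_trans nlearn_ge nlearn_le_total.
case: group_cases => hg.
  have : (4096 * budget) * (4096 * budget) * eps ^+ 4 <=
      ngroup%:R * (ngroups%:R * ngroup%:R) * eps ^+ 2.
    apply: ler_pM => //; first by apply: mulr_ge0; lra.
    apply: ler_pM => //; first lra; first lra.
    exact: le_trans nlearn_ge hg.
  have := ler_peMr n0R L1; have := budget_sq_ge; rewrite expr2; lra.
have b2 : 1 <= budget * eps ^+ 2 by apply: le_trans budget_ge.
have : n%:R * (4096 * budget * eps ^+ 2) <=
    2 * ngroup%:R * (ngroups%:R * ngroup%:R * eps ^+ 2).
  apply: ler_pM => //; first by apply: mulr_ge0; lra.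
  exact: ler_wpM2r.
by have := ler_wpM2l n0R b2; lra.
Qed.

(** Bernoulli's inequality, in the form [hit_le], with [2 * (ngroup - 1) <= n]. *)
Lemma ngroup_half : 2^-1 <= (1 - n%:R^-1 : R) ^+ ngroup.-1.
Proof.
have q01 : 0 <= (n%:R^-1 : R) <= 1 by rewrite invr_ge0 ler0n invf_le1 ?ler1n ?ltr0n.
have := hit_le ngroup.-1 q01.
suff : ngroup.-1%:R * n%:R^-1 <= 2^-1 :> R.
  by rewrite /hit; set a := _ ^+ _; lra.
rewrite ler_pdivrMr ?ltr0n //.
suff : 2 * ngroup.-1%:R <= n%:R :> R by lra.
rewrite -natrM ler_nat.
have nat_ineq (g N : nat) : (0 < g)%N -> (g <= uphalf N)%N -> (2 * g.-1 <= N)%N.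
  by clear; lia.
exact: nat_ineq ngroup_gt0 (geq_minr _ _).
Qed.

Lemma ngroup_le : (ngroup <= n)%N.
Proof.
apply: leq_trans (geq_minr _ _) _; rewrite leq_uphalf_double -addnn.
exact: leq_addr.
Qed.

End Sizes.

Theorem theorem3p2 :
  exists C : R, 0 < C /\
  exists A : forall n k : nat, R -> alg n k,
  forall (n k : nat) (eps : R) (P : 'I_n -> R),
    leq 2 k -> leq 1 n -> 0 < eps -> eps <= 1 ->
    is_distr P -> eps <= dTV P (unif n) ->
    (forall b : 'I_k -> bool,
        8 / 9 <= succ_prob (A n k eps) (sources P b) (correct b)) /\
    (nsamples (A n k eps))%:R <= bound C n k eps.
Proof.
exists (2 * 4097 + 14 * (64 * 64 * 128 + 1)); split; first lra.
exists (fun n k eps => classifier n k (ngroups n k eps) (ngroup n k eps)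
  (nblock n k eps) (nvotes k)).
move=> n k eps P k2 n0 eps0 eps1 dP farP.
have t0 := ngroup_gt0 k eps n0; have hq := ngroup_half k eps n0.
split=> [b|]; last first.
  rewrite boundE; apply: le_trans (total_le n k2 eps0 eps1).
  by rewrite ler_nat nsamples_classifier.
rewrite -(prednK t0); apply: (classifier_correct _ dP n0 (ltn0Sn _) (ltn0Sn _) hq _ eps0 farP).
- rewrite (prednK t0); exact: ngroup_le.
- apply: (signal_suff dP n0 hq eps0 farP); rewrite (prednK t0); exact: learn_ge.
- apply: (block_suff dP n0 (ltn0Sn _) hq eps0 farP).
    rewrite (prednK t0); exact: block_total_ge.
  rewrite (prednK t0); exact: block_group_ge.
- exact: nvotes_ge.
Qed.
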